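(* Suppose the maximum degree $\Delta$ of any vertex of $G$ is at most $m^{1/2-\alpha}$, where $\alpha>0$, and $t\le C\le\min(m^{2\alpha},m^{1/3})$. Then the expected number (over the random coloring) of $2k$-tuples $\vec T=(\vec T_1,\vec T_2)$ of edges of $\vec G$ such that $\vec T_1$ and $\vec T_2$ are both distinctly color-compatible, $\vec T$ satisfies Condition 1, 2 or 3 at every vertex of $H$, and $\vec T$ satisfies Condition 2 at some vertex of $H$, is $O(m^k/C^{2k-t})$, with implied constant depending only on $H$.
   Context: $H$ is a fixed connected finite simple graph with no leaves, vertices $1,\dots,t$, $k$ edges, oriented arbitrarily as $\vec H$ with directed edges $\overrightarrow{a_1a_2},\dots,\overrightarrow{a_{2k-1}a_{2k}}$, $a_i\in\{1,\dots,t\}$; $\Gamma(b)=\{i\in\{1,\dots,2k\}:a_i=b\}$. $G$ is a finite simple graph; $\vec G$ replaces each edge $vw$ by $\overrightarrow{vw},\overrightarrow{wv}$; $m$ is the number of edges of $\vec G$. A coloring $\mathcal C:V(G)\to\{1,\dots,C\}$ is chosen uniformly from a $4k$-wise independent family of hash functions, each value uniform. A $k$-tuple $(\overrightarrow{u_1u_2},\dots,\overrightarrow{u_{2k-1}u_{2k}})$ of edges of $\vec G$ is distinctly color-compatible if there are pairwise distinct colors $c_1,\dots,c_t$ with $\mathcal C(u_i)=c_{a_i}$ for all $1\le i\le 2k$. Write $\vec T_1=(\overrightarrow{v_1v_2},\dots,\overrightarrow{v_{2k-1}v_{2k}})$, $\vec T_2=(\overrightarrow{w_1w_2},\dots,\overrightarrow{w_{2k-1}w_{2k}})$.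 Conditions at a vertex $b$ of $H$: Condition 1: the $v_i$, $i\in\Gamma(b)$, are all equal and the $w_i$, $i\in\Gamma(b)$, are all equal. Condition 2: $v_i=w_i$ for all $i\in\Gamma(b)$. Condition 3: there are vertices $x,y$ of $G$ such that for every $i\in\Gamma(b)$, either ($v_i=x$, $w_i=y$) or ($v_i=y$, $w_i=x$). *)

(* Defs.v *)
From mathcomp Require Import all_boot all_order all_algebra.
From mathcomp Require Import reals exp.

Set Implicit Arguments.
Unset Strict Implicit.
Unset Printing Implicit Defensive.

Import Order.TTheory GRing.Theory Num.Theory.
Local Open Scope ring_scope.

Section Graphs.
Variables (V : finType) (E : rel V).

Definition simple_graph : Prop := symmetric E /\ irreflexive E.

Definition nbrs (v : V) : {set V} := [set w | E v w].

Definition degree (v : V) : nat := #|nbrs v|.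

Definition max_degree : nat := \max_(v : V) degree v.

Definition connected_graph : Prop :=
  (0 < #|V|)%N /\ forall x y, connect E x y.

Definition no_leaves : Prop := forall v, degree v != 1%N.

(* The directed version of the graph: each edge vw gives (v, w) and (w, v). *)
Definition darcs : {set V * V} := [set p | E p.1 p.2].

(* k-tuples of directed edges, repetitions allowed. *)
Definition darc_tuples (k : nat) : {set {ffun 'I_k -> V * V}} :=
  [set T : {ffun 'I_k -> V * V} | [forall j, T j \in darcs]].

(* a lists the edges of the graph, each exactly once and in one direction. *)
Definition orientation (k : nat) (a : {ffun 'I_k -> V * V}) : Prop :=
  (forall j, E (a j).1 (a j).2) /\
  (forall x y, E x y -> exists! j, a j = (x, y) \/ a j = (y, x)).

End Graphs.

(* The 2k indices of a list (u_1 u_2, ..., u_(2k-1) u_(2k)) of directed edges  *)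
(* are encoded by 'I_k * bool: with j counted from 0, (j, false) stands for    *)
(* the index 2j+1 and (j, true) for 2j+2.                                      *)
Definition endpt (V : finType) (k : nat) (T : {ffun 'I_k -> V * V})
    (i : 'I_k * bool) : V :=
  if i.2 then (T i.1).2 else (T i.1).1.

Section Tuples.
Variables (I V : finType) (k : nat) (a : {ffun 'I_k -> I * I}).
Implicit Types T : {ffun 'I_k -> V * V}.

Definition Gamma (b : I) : {set 'I_k * bool} := [set i | endpt a i == b].

Definition distinctly_compatible (C : nat) (col : V -> 'I_C) T : bool :=
  [exists c : {ffun I -> 'I_C},
     injectiveb c && [forall i, col (endpt T i) == c (endpt a i)]].

Definition cond1 T1 T2 (b : I) : bool :=
  [forall i in Gamma b, forall j in Gamma b,
     (endpt T1 i == endpt T1 j) && (endpt T2 i == endpt T2 j)].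

Definition cond2 T1 T2 (b : I) : bool :=
  [forall i in Gamma b, endpt T1 i == endpt T2 i].

Definition cond3 T1 T2 (b : I) : bool :=
  [exists x : V, exists y : V, forall i in Gamma b,
     ((endpt T1 i == x) && (endpt T2 i == y))
     || ((endpt T1 i == y) && (endpt T2 i == x))].

Definition counted_pairs (E : rel V) (C : nat) (col : V -> 'I_C) :
    {set {ffun 'I_k -> V * V} * {ffun 'I_k -> V * V}} :=
  [set T | [&& T.1 \in darc_tuples E k, T.2 \in darc_tuples E k,
      distinctly_compatible col T.1, distinctly_compatible col T.2,
      [forall b, [|| cond1 T.1 T.2 b, cond2 T.1 T.2 b | cond3 T.1 T.2 b]]
    & [exists b, cond2 T.1 T.2 b]]].

End Tuples.

(* Uniform choice from a finite sample space W. *)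
Definition uprob (R : realType) (W : finType) (A : pred W) : R :=
  #|A|%:R / #|W|%:R.

Definition uexpect (R : realType) (W : finType) (X : W -> R) : R :=
  (\sum_w X w) / #|W|%:R.

(* An r-wise independent family (h w), w in W, of functions V -> 'I_C, under   *)
(* the uniform choice of w, with each single value uniform.  The product rule  *)
(* is imposed on every set of at most r points, so that it is not vacuous when *)
(* V has fewer than r points.                                                  *)
Definition hash_family (R : realType) (V W : finType) (C r : nat)
    (h : W -> V -> 'I_C) : Prop :=
  [/\ (0 < #|W|)%N,
      forall (x : V) (c : 'I_C),
        uprob R [pred w | h w x == c] = C%:R^-1
    & forall (S : {set V}) (c : V -> 'I_C), (#|S| <= r)%N ->
        uprob R [pred w | [forall x in S, h w x == c x]] =
        \prod_(x in S) uprob R [pred w | h w x == c x]].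

(* Main.v *)
(* The degree and color hypotheses enter only through D^2 C <= m and C^3 <= m,  *)
(* where D is the maximum degree of G.  Let n be the number of vertices of H    *)
(* where Condition 2 fails and s the number of vertices of G used by T.  Given  *)
(* T, a coloring compatible with T1 and T2 is determined on these s vertices by *)
(* two colors at each of the n vertices and one at the others, so it has        *)
(* probability at most C^(t+n-s).  Given which endpoints of T coincide, expose  *)
(* the 2k arcs one at a time, preferring arcs that touch an exposed vertex: a   *)
(* touching arc brings at most one new vertex and D choices, any other one two  *)
(* new vertices and m choices, so T can be chosen in at most m^u D^(s-2u) ways  *)
(* with u fresh starts.  As H has no leaves, is connected and has a vertex      *)
(* satisfying Condition 2, k - n starts suffice.  With s <= 2k these bounds     *)
(* multiply to m^k C^(t-2k), and the number of coincidence patterns depends on  *)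
(* k only.                                                                      *)

Require Import Defs.
From mathcomp Require Import all_boot all_order all_algebra.
From mathcomp Require Import reals exp.
From mathcomp Require Import zify ring.

Set Implicit Arguments.
Unset Strict Implicit.
Unset Printing Implicit Defensive.

Import Order.TTheory GRing.Theory Num.Theory.
Local Open Scope ring_scope.

(** By linearity the expectation is the sum, over [admissible_pairs], of the probability that both
    halves of T are compatible, which [prob_compatible] bounds by C^(t+n-s). The sum is split by
    coincidence pattern ([pair_kernel]), which fixes n and s. [card_exploration] bounds each class
    by m^u D^(s-2u), where u is at most the size of a set of arcs from which shared vertices lead to
    all others; [spanning_starts] supplies such a set of at most k-n arcs. The exponents balance
    because D is at most (m/C)^(1/2): a class has at most m^(s/2) C^(u-s/2) members, and s <= 2k
    ([card_pair_verts]) with C^3 <= m bounds m^(s/2) by m^k C^(-3(2k-s)/2). The total exponent of C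
    is then t+n+u-3k, at most t-2k since u+n <= k ([exploration_arith]). *)

Definition pair_at (V : Type) (p : V * V) (e : bool) : V := if e then p.2 else p.1.

Lemma card_le_fibers (X Y : finType) (A : {set X}) (q : X -> Y) (B : {set Y})
    (n : nat) :
  (forall x, x \in A -> q x \in B) ->
  (forall y, y \in B -> #|[set x in A | q x == y]| <= n)%N ->
  (#|A| <= #|B| * n)%N.
Proof.
move=> AB fib; rewrite -sum1_card (partition_big q (mem B)) //=.
rewrite -sum_nat_const; apply: leq_sum => y /fib; apply: leq_trans.
by rewrite -sum1_card leq_eqVlt; apply/orP; left; apply/eqP/eq_bigl => x; rewrite inE.
Qed.

(** An image is in bijection with the fibers of its map, and equal kernels give equal fibers. *)
Lemma card_imset_kernel (X Y Z : finType) (f : X -> Y) (g : X -> Z) :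
  (forall x y, (f x == f y) = (g x == g y)) ->
  #|[set f x | x : X]| = #|[set g x | x : X]|.
Proof.
have fibers (U : finType) (q : X -> U) :
    #|[set q x | x : X]| = #|[set [set y | q y == q x] | x : X]|.
  rewrite [in RHS](imset_comp (fun c => [set y | q y == c]) q) card_in_imset //.
  move=> _ _ /imsetP[x _ ->] /imsetP[y _ ->] /setP/(_ x).
  by rewrite !inE eqxx => /esym/eqP.
move=> fg; rewrite (fibers _ f) (fibers _ g); congr #|pred_of_set _|.
apply: eq_imset => x.
by apply/setP => y; rewrite !inE fg.
Qed.

Lemma degree_le_max (V : finType) (G : rel V) (v : V) :
  (degree G v <= max_degree G)%N.
Proof. exact: leq_bigmax. Qed.

(** * Counting arc families with a prescribed coincidence pattern *)

Section Exploration.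
Variables (X J V : finType) (G : rel V) (arc : X -> J -> V * V).
Variables (F : {set X}) (g : X) (St : {set J}).
Hypotheses (Gsym : symmetric G) (Girr : irreflexive G).
Hypothesis arc_inj : forall f f', arc f =1 arc f' -> f = f'.
Hypothesis F_arcs : forall f j, f \in F -> arc f j \in darcs G.
Hypothesis gF : g \in F.
Hypothesis F_kernel : forall f, f \in F -> forall j j' e e',
  (pair_at (arc f j) e == pair_at (arc f j') e') =
  (pair_at (arc g j) e == pair_at (arc g j') e').
Hypothesis St_spans : forall Y : {set J}, St \subset Y ->
  (forall j j' e e', j \in Y ->
     pair_at (arc g j) e = pair_at (arc g j') e' -> j' \in Y) -> Y = setT.

Let seen (Y : {set J}) : {set V} :=
  [set pair_at (arc g x.1) x.2 | x : J * bool & x.1 \in Y].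

Let seenP (Y : {set J}) j e : reflect (exists j' e', j' \in Y /\
    pair_at (arc g j) e = pair_at (arc g j') e') (pair_at (arc g j) e \in seen Y).
Proof.
apply: (iffP imsetP) => [[[j' e']]|[j' [e' [j'Y eq]]]].
  by rewrite inE /= => j'Y ->; exists j', e'.
by exists (j', e'); rewrite ?inE.
Qed.

Let seenU j (Y : {set J}) e : seen (j |: Y) =
  pair_at (arc g j) e |: (pair_at (arc g j) (~~ e) |: seen Y).
Proof.
apply/setP => v; apply/imsetP/idP => [[[j' e']]|].
  rewrite !inE /= => /orP[/eqP->|j'Y] ->.
    by case: e e' => [] []; rewrite eqxx ?orbT.
  have -> : pair_at (arc g j') e' \in seen Y by apply/seenP; exists j', e'.
  by rewrite !orbT.
rewrite !inE => /or3P[/eqP->|/eqP->|/imsetP[[j' e']]].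
- by exists (j, e); rewrite ?inE /= ?eqxx.
- by exists (j, ~~ e); rewrite ?inE /= ?eqxx.
by rewrite inE /= => j'Y ->; exists (j', e'); rewrite ?inE /= ?j'Y ?orbT.
Qed.

Let ends_neq j e : pair_at (arc g j) e != pair_at (arc g j) (~~ e).
Proof.
have := F_arcs j gF; rewrite inE; case: (arc g j) => x y /=.
by case: e; apply: contraTneq => /= ->; rewrite Girr.
Qed.

Let agree (Y : {set J}) (f0 : X) : {set X} :=
  [set f in F | [forall j in Y, arc f j == arc f0 j]].

(** One level of the search tree: [d] bounds the values of the next arc, [n] the completions once it
    is fixed. *)
Let agree_step (Y : {set J}) j (B : X -> {set V * V}) n d :
  (forall f0 f, f0 \in F -> f \in agree Y f0 -> arc f j \in B f0) ->
  (forall f0, f0 \in F -> #|B f0| <= d)%N ->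
  (forall f0, f0 \in F -> #|agree (j |: Y) f0| <= n)%N ->
  forall f0, f0 \in F -> (#|agree Y f0| <= d * n)%N.
Proof.
move=> AB Bd IH f0 f0F.
apply: (@leq_trans (#|B f0| * n)); last by rewrite leq_mul2r Bd ?orbT.
apply: (card_le_fibers (q := fun f => arc f j)) => [f|p _]; first exact: AB.
case: (set_0Vmem [set f in agree Y f0 | arc f j == p]) => [->|[f1]].
  by rewrite cards0.
rewrite !inE -andbA => /and3P[f1F /forall_inP f1Y /eqP f1j].
apply: leq_trans (IH _ f1F); apply: subset_leq_card; apply/subsetP => f.
rewrite !inE -andbA => /and3P[-> /forall_inP fY /eqP fj] /=.
apply/forall_inP => i; rewrite !inE => /orP[/eqP->|iY]; first by rewrite fj f1j.
by rewrite (eqP (fY _ iY)) (eqP (f1Y _ iY)).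
Qed.

Let agreeT f0 : (#|agree setT f0| <= 1)%N.
Proof.
rewrite -(cards1 f0); apply: subset_leq_card; apply/subsetP => f.
rewrite !inE => /andP[_ /forall_inP ff0].
by apply/eqP/arc_inj => i; apply/eqP/ff0.
Qed.

(** Induction on the number of unexposed arcs. Each fresh start consumes an unexposed arc of [St],
    which bounds [u]; the unseen vertices of [g] are counted two per fresh start and one per
    touching arc with a new end. *)
Let explore n : forall Y : {set J}, (#|~: Y| <= n)%N -> exists u v,
  [/\ (u <= #|St :\: Y|)%N, (2 * u + v + #|seen Y|)%N = #|seen setT|
    & forall f0, f0 \in F ->
        (#|agree Y f0| <= #|darcs G| ^ u * max_degree G ^ v)%N].
Proof.
elim: n => [|n IHn] Y leYn; last first.
  have IHY j : j \notin Y -> exists u v,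
    [/\ (u <= #|St :\: (j |: Y)|)%N,
        (2 * u + v + #|seen (j |: Y)|)%N = #|seen setT|
      & forall f0, f0 \in F ->
        (#|agree (j |: Y) f0| <= #|darcs G| ^ u * max_degree G ^ v)%N].
    move=> jY; apply: IHn; move: leYn; rewrite (cardsD1 j) inE jY ltnS.
    by rewrite setCU setDE setIC.
  case: (boolP [exists j, exists e, (j \notin Y) && (pair_at (arc g j) e \in seen Y)]).
    move=> /existsP[j /existsP[e /andP[jY jeY]]].
    have [u [v [uSt uv IH]]] := IHY _ jY.
    have uSt' : (u <= #|St :\: Y|)%N.
      by apply: leq_trans uSt (subset_leq_card _); rewrite setDS ?subsetUr.
    have [j1 [e1 [j1Y eq1]]] := seenP _ _ _ jeY.
    have end1 f0 f : f0 \in F -> f \in agree Y f0 ->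
        pair_at (arc f j) e = pair_at (arc f0 j1) e1.
      rewrite inE => f0F /andP[fF /forall_inP/(_ _ j1Y)/eqP <-].
      by apply/eqP; rewrite F_kernel // eq1.
    (* If the other end is exposed too, the pattern determines the arc; otherwise that end is a
       neighbor of a known vertex. *)
    case: (boolP (pair_at (arc g j) (~~ e) \in seen Y)) => [jneY|njY].
      have [j2 [e2 [j2Y eq2]]] := seenP _ _ _ jneY.
      exists u, v; split=> //.
        by rewrite -uv (seenU _ _ e) !(setUidPr _) // sub1set ?inE ?jeY ?orbT.
      move=> f0 f0F; rewrite -[leqRHS]mul1n.
      apply: (agree_step (j := j) (B := fun f0 => [set arc f0 j])) f0F => //.
        move=> {}f0 f f0F fA; rewrite inE; apply/eqP.
        have end2 f' : f' \in agree Y f0 ->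
            pair_at (arc f' j) (~~ e) = pair_at (arc f0 j2) e2.
          rewrite inE => /andP[f'F /forall_inP/(_ _ j2Y)/eqP <-].
          by apply/eqP; rewrite F_kernel // eq2.
        have f0A : f0 \in agree Y f0.
          by rewrite inE f0F; apply/forall_inP.
        have E1 := end1 _ _ f0F fA; have E1' := end1 _ _ f0F f0A.
        have E2 := end2 _ fA; have E2' := end2 _ f0A.
        rewrite -E1' in E1; rewrite -E2' in E2.
        move: E1 E2; rewrite /pair_at; case: (arc f j) (arc f0 j) => [x y] [x' y'].
        by case: (e) => /= -> ->.
      by move=> {}f0 f0F; rewrite cards1.
    exists u, v.+1; split=> //.
      rewrite -uv (seenU _ _ e) (setUidPr _) ?sub1set ?inE ?jeY ?orbT //.
      by rewrite cardsU1 njY; lia.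
    move=> f0 f0F; rewrite expnS mulnCA.
    apply: (agree_step (j := j) (B := fun f0 => let p := pair_at (arc f0 j1) e1 in
      [set (if e then (w, p) else (p, w)) | w in nbrs G p])) f0F => //.
      move=> {}f0 f f0F fA /=; rewrite -(end1 _ _ f0F fA).
      move: fA; rewrite inE => /andP[fF _].
      apply/imsetP; exists (pair_at (arc f j) (~~ e)).
        rewrite inE; have := F_arcs j fF; rewrite inE.
        by case: (e) => //=; rewrite Gsym.
      by case: (e) => /=; case: (arc f j).
    move=> {}f0 f0F /=; apply: leq_trans (leq_imset_card _ _) _.
    exact: degree_le_max.
  rewrite negb_exists => /forallP clY.
  have {}clY j e : j \notin Y -> pair_at (arc g j) e \notin seen Y.
    move=> jY; have := clY j; rewrite negb_exists => /forallP/(_ e).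
    by rewrite jY.
  (* No unexposed arc touches an exposed vertex, so [Y] is closed: it is everything if it contains
     [St], and otherwise an arc of [St] brings two new vertices. *)
  case: (boolP (St \subset Y)) => [StY|/subsetPn[j jSt jY]].
    have YT : Y = setT.
      apply: (St_spans StY) => j j' e e' jY eq.
      apply/negPn/negP => j'Y; have /negP[] := clY _ e' j'Y.
      by rewrite -eq; apply/seenP; exists j, e.
    exists 0%N, 0%N; split=> //; first by rewrite YT.
    by move=> f0 _; rewrite YT agreeT.
  have [u [v [uSt uv IH]]] := IHY _ jY.
  exists u.+1, v; split=> //.
  - rewrite (cardsD1 j) inE jY jSt /= add1n ltnS.
    by apply: leq_trans uSt (subset_leq_card _); rewrite setDDl setUC.
  - rewrite -uv (seenU _ _ false) !cardsU1 !inE negb_or ends_neq.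
    by rewrite !(negPf (clY _ _ jY)) /=; lia.
  move=> f0 f0F; rewrite expnS -mulnA.
  apply: (agree_step (j := j) (B := fun=> darcs G)) f0F => // f1 f f1F.
  by rewrite inE => /andP[/F_arcs].
have YT : Y = setT.
  by rewrite -[Y]setCK; move: leYn; rewrite leqn0 cards_eq0 => /eqP->; rewrite setC0.
exists 0%N, 0%N; split=> //; first by rewrite YT.
by move=> f0 _; rewrite YT agreeT.
Qed.

Lemma card_exploration : exists u v,
  [/\ (u <= #|St|)%N,
      (2 * u + v)%N = #|[set pair_at (arc g x.1) x.2 | x : J * bool]|
    & (#|F| <= #|darcs G| ^ u * max_degree G ^ v)%N].
Proof.
have [u [v [uSt uv le]]] := explore (leqnn #|~: (set0 : {set J})|).
exists u, v; split; first by rewrite setD0 in uSt.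
  move: uv; have -> : seen set0 = set0.
    by apply/setP => x; rewrite inE; apply/imsetP => -[y]; rewrite !inE.
  rewrite cards0 addn0 => ->; congr #|pred_of_set _|.
  by apply/setP => x; apply/imsetP/imsetP => -[y _ ->]; exists y; rewrite ?inE.
apply: leq_trans (le g gF); apply: subset_leq_card; apply/subsetP => f fF.
by rewrite inE fF; apply/forall_inP => j; rewrite inE.
Qed.

End Exploration.

(** * Probability that a coloring is compatible with both tuples *)

Lemma card_union_bound (X Y : finType) (A : {set X}) (B : Y -> {set X}) :
  (forall x, x \in A -> exists y, x \in B y) -> (#|A| <= \sum_y #|B y|)%N.
Proof.
move=> AB.
have -> : (\sum_y #|B y| = \sum_x \sum_y (x \in B y))%N.
  rewrite exchange_big; apply: eq_bigr => y _.
  by rewrite -sum1_card big_mkcond; apply: eq_bigr => x _; case: ifP.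
rewrite -sum1_card big_mkcond; apply: leq_sum => x _.
by case: ifP => // /AB[y xy]; rewrite (bigD1 y) //= xy.
Qed.

Section Pairs.
Variables (I V : finType) (k : nat) (a : {ffun 'I_k -> I * I}).
Implicit Types T : {ffun 'I_k -> V * V} * {ffun 'I_k -> V * V}.

(** Merges the arcs of both tuples into one family of 2k arcs, the form the exploration takes; the
    boolean selects the tuple. *)
Definition pair_arc T (x : 'I_k * bool) : V * V := (pair_at T x.2) x.1.

Definition pair_verts T : {set V} :=
  [set pair_at (pair_arc T x.1) x.2 | x : 'I_k * bool * bool].

Definition uncond2 T : {set I} := [set b | ~~ cond2 a T.1 T.2 b].

Lemma pair_vertsP T v :
  reflect (exists s i, v = endpt (pair_at T s) i) (v \in pair_verts T).
Proof.
apply: (iffP imsetP) => [[[[j s] e] _ ->]|[s [i ->]]]; first by exists s, (j, e).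
by exists (i.1, s, i.2).
Qed.

(** The colors of [T.1] cover its own vertices. A vertex met only in [T.2] lies over a vertex of H
    where Condition 2 fails, so a second color is needed only there; the defaults [phi (inl b0)] are
    never reached on [pair_verts T]. *)
Lemma compatible_assignment (C : nat) (b0 : I) T :
  exists z : {ffun I + {b | b \in uncond2 T} -> 'I_C} -> V -> 'I_C,
  forall col : V -> 'I_C,
    distinctly_compatible a col T.1 -> distinctly_compatible a col T.2 ->
    exists phi, forall v, v \in pair_verts T -> col v = z phi v.
Proof.
pose z (phi : {ffun I + {b | b \in uncond2 T} -> 'I_C}) v :=
  if [pick i | endpt T.1 i == v] is Some i then phi (inl (endpt a i)) else
  if [pick i | endpt T.2 i == v] is Some i then
    if insub (endpt a i) is Some b then phi (inr b) else phi (inl b0)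
  else phi (inl b0).
exists z => col /existsP[c1 /andP[_ /forallP col1]] /existsP[c2 /andP[_ /forallP col2]].
exists [ffun x => match x with inl b => c1 b | inr b => c2 (val b) end].
move=> v /pair_vertsP vT; rewrite /z; case: pickP => [i /eqP<-|no1].
  by rewrite ffunE (eqP (col1 i)).
case: pickP => [i /eqP vi|no2]; last first.
  by case: vT => -[] [i vi]; [have := no2 i | have := no1 i]; rewrite vi eqxx.
case: insubP => [b _ bi|]; first by rewrite ffunE bi -(eqP (col2 i)) vi.
rewrite inE negbK => /forall_inP/(_ i); rewrite inE eqxx => /(_ isT).
by have := no1 i; rewrite vi => ->.
Qed.

(** Union bound over the C^(t+n) assignments [phi]; by independence each one fixes the colors of s
    vertices with probability C^(-s). *)
Lemma prob_compatible (R : realType) (W : finType) (C r : nat)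
    (h : W -> V -> 'I_C) (b0 : I) T :
  hash_family R r h -> (#|pair_verts T| <= r)%N ->
  #|[set w | distinctly_compatible a (h w) T.1 &&
             distinctly_compatible a (h w) T.2]|%:R / #|W|%:R
  <= C%:R ^+ (#|I| + #|uncond2 T|) / C%:R ^+ #|pair_verts T| :> R.
Proof.
move=> [W0 unif indep] leTr; have [z zP] := compatible_assignment C b0 T.
have W0R : 0 < #|W|%:R :> R by rewrite ltr0n.
have fiber phi :
    #|[set w | [forall v in pair_verts T, h w v == z phi v]]|%:R =
    #|W|%:R / C%:R ^+ #|pair_verts T| :> R.
  have := indep _ (z phi) leTr; under eq_bigr do rewrite unif.
  rewrite prodr_const exprVn /uprob cardsE => /(canRL (mulfVK _)) ->.
    by rewrite mulrC.
  by rewrite gt_eqF.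
have le : (#|[set w | distinctly_compatible a (h w) T.1 &&
             distinctly_compatible a (h w) T.2]| <=
    \sum_phi #|[set w | [forall v in pair_verts T, h w v == z phi v]]|)%N.
  apply: card_union_bound => w; rewrite inE => /andP[/zP c1 /c1[phi hw]].
  by exists phi; rewrite inE; apply/forall_inP => v /hw/eqP.
rewrite ler_pdivrMr //; move: le; rewrite -(ler_nat R) => /le_trans; apply.
rewrite natr_sum (eq_bigr _ (fun phi _ => fiber phi)) sumr_const.
rewrite card_ffun card_ord card_sum card_sig -[leLHS]mulr_natl natrX.
by rewrite mulrCA mulrC.
Qed.

(** Under Condition 1 or 3 the set of the two ends lying over [b] is the same for every index in
    [Gamma a b]; only Condition 3 may exchange the tuples. *)
Lemma uncond2_swap T b s i i' :
  [|| cond1 a T.1 T.2 b, cond2 a T.1 T.2 b | cond3 a T.1 T.2 b] ->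
  b \in uncond2 T -> i \in Gamma a b -> i' \in Gamma a b ->
  exists s', endpt (pair_at T s) i = endpt (pair_at T s') i'.
Proof.
rewrite inE => /or3P[c1|->//|/existsP[x /existsP[y /forall_inP c3]]] _ ib i'b.
  have /andP[/eqP e1 /eqP e2] := forall_inP (forall_inP c1 _ ib) _ i'b.
  by exists s; case: s.
have := c3 _ ib; have := c3 _ i'b.
move=> /orP[]/andP[/eqP e1 /eqP e2] /orP[]/andP[/eqP e3 /eqP e4];
  solve [exists s; case: s; rewrite /= ?e1 ?e2 ?e3 ?e4 // |
         exists (~~ s); case: s; rewrite /= ?e1 ?e2 ?e3 ?e4 //].
Qed.

End Pairs.

(** * Structure of H: distances, degrees and spanning starts *)

Lemma connected_rank (I : finType) (H : rel I) (Z : {set I}) (b0 : I) :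
  connected_graph H -> b0 \in Z ->
  exists rank : I -> nat, forall b, b \notin Z ->
    exists2 b', H b b' & (rank b' < rank b)%N.
Proof.
move=> [_ conn] b0Z.
pose walk b n := [exists p : n.-tuple I, path H b p && (last b p \in Z)].
have walkP b : exists n, walk b n.
  have /connectP[p pb bp] := conn b b0; exists (size p).
  by apply/existsP; exists (in_tuple p); rewrite pb -bp.
exists (fun b => ex_minn (walkP b)) => b bZ.
case: (ex_minnP (walkP b)) => n /existsP[[[|b' p] /= pn]].
  by rewrite (negPf bZ).
move=> /andP[/andP[bb' pb'] lZ] _; exists b' => //.
case: ex_minnP => n' _ /(_ (size p)); rewrite -(eqP pn) ltnS; apply.
by apply/existsP; exists (in_tuple p); rewrite pb'.
Qed.

Section Orientation.
Variables (I V : finType) (k : nat) (H : rel I) (a : {ffun 'I_k -> I * I}).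
Hypotheses (H_simple : simple_graph H) (H_connected : connected_graph H).
Hypotheses (H_no_leaves : no_leaves H) (aH : orientation H a).

Definition opp_end (i : 'I_k * bool) := (i.1, ~~ i.2).

Lemma adj_ends i : H (endpt a i) (endpt a (opp_end i)).
Proof. by case: i => j [] /=; have := aH.1 j; rewrite // H_simple.1. Qed.

Lemma half_edge b b' : H b b' ->
  exists2 i, endpt a i = b & endpt a (opp_end i) = b'.
Proof.
move=> /(aH.2 b b')[j [[] ajb _]]; [exists (j, false) | exists (j, true)];
by rewrite /endpt /= ajb.
Qed.

Lemma another_neighbor b b' : H b b' -> exists2 b'', H b b'' & b'' != b'.
Proof.
move=> bb'; have := H_no_leaves b; rewrite /degree (cardsD1 b') inE bb' eqSS.
by rewrite cards_eq0 => /set0Pn[b'']; rewrite !inE => /andP[]; exists b''.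
Qed.

Lemma card_Gamma_ge2 b b' : H b b' -> (2 <= #|Gamma a b|)%N.
Proof.
move=> bb'; have [b'' bb'' neq] := another_neighbor bb'.
have [i ib ib'] := half_edge bb'; have [i' i'b i'b''] := half_edge bb''.
rewrite (cardsD1 i) inE ib eqxx ltnS card_gt0; apply/set0Pn; exists i'.
rewrite !inE i'b eqxx andbT; apply: contraNneq neq => ii'.
by rewrite -ib' -i'b'' ii'.
Qed.

Lemma sum_card_Gamma : (\sum_b #|Gamma a b| = 2 * k)%N.
Proof.
transitivity #|{: 'I_k * bool}|; last by rewrite card_prod card_bool card_ord mulnC.
rewrite -sum1_card (partition_big (endpt a) xpredT) //=.
by apply: eq_bigr => b _; rewrite -sum1_card; apply: eq_bigl => i; rewrite inE.
Qed.

Variable T : {ffun 'I_k -> V * V} * {ffun 'I_k -> V * V}.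
Hypothesis T_cond : forall b,
  [|| cond1 a T.1 T.2 b, cond2 a T.1 T.2 b | cond3 a T.1 T.2 b].
Variable b0 : I.
Hypothesis b0_cond2 : cond2 a T.1 T.2 b0.

Lemma uncond2_edge b : b \in uncond2 a T -> exists i, i \in Gamma a b.
Proof. by rewrite inE negb_forall_in => /exists_inP[i ib _]; exists i. Qed.

(** Each vertex of G is charged to a vertex [b] of H below it. Where Condition 2 holds, [b] receives
    at most one per index of [Gamma a b]; elsewhere at most two, and [Gamma a b] has two indices as
    H has no leaves. *)
Lemma card_pair_verts : (#|pair_verts T| <= 2 * k)%N.
Proof.
pose VT b := [set endpt (pair_at T x.2) x.1 | x in setX (Gamma a b) [set: bool]].
have sub : pair_verts T \subset \bigcup_b VT b.
  apply/subsetP => v /pair_vertsP[s [i ->]]; apply/bigcupP.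
  exists (endpt a i) => //; apply/imsetP; exists (i, s) => //.
  by rewrite !inE eqxx.
apply: leq_trans (subset_leq_card sub) _.
apply: (@leq_trans (\sum_b #|VT b|)).
  by apply: card_union_bound => v /bigcupP[b _]; exists b.
rewrite -sum_card_Gamma; apply: leq_sum => b _.
case: (boolP (b \in uncond2 a T)) => [bT|]; last first.
  rewrite inE negbK => /forall_inP c2.
  apply: leq_trans (leq_imset_card (endpt T.1) _); apply: subset_leq_card.
  apply/subsetP => v /imsetP[[i s] /setXP[ib _] ->].
  by apply/imsetP; exists i => //; case: s => //=; rewrite (eqP (c2 _ ib)).
have [i ib] := uncond2_edge bT.
have /card_Gamma_ge2 : H b (endpt a (opp_end i)).
  by have := adj_ends i; move: ib; rewrite inE => /eqP->.
apply: leq_trans; apply: leq_trans (_ : #|[set endpt T.1 i; endpt T.2 i]| <= 2)%N.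
  apply: subset_leq_card; apply/subsetP => v /imsetP[[i' s] /setXP[i'b _] ->].
  have [[] ->] := uncond2_swap s (T_cond b) bT i'b ib; by rewrite !inE eqxx ?orbT.
by rewrite cards2; case: eqP.
Qed.

(* Every vertex where Condition 2 fails has a parent edge leading towards the  *)
(* vertices where it holds; exploring from the edges that are nobody's parent  *)
(* reaches every parent edge (going away from those vertices, each one has a   *)
(* second edge), and then both copies of every edge.                           *)
Lemma spanning_starts : exists St : {set 'I_k * bool},
  (#|St| + #|uncond2 a T| <= k)%N /\
  forall Y : {set 'I_k * bool}, St \subset Y ->
    (forall x x' e e', x \in Y ->
      pair_at (pair_arc T x) e = pair_at (pair_arc T x') e' -> x' \in Y) ->
    Y = setT.
Proof.
have [|rank rankP] := @connected_rank I H (~: uncond2 a T) b0 H_connected.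
  by rewrite !inE negbK.
have parent (b : {b | b \in uncond2 a T}) : exists i,
    endpt a i = val b /\ (rank (endpt a (opp_end i)) < rank (val b))%N.
  have [|b' bb' lt] := rankP (val b); first by rewrite inE negbK (valP b).
  by have [i ib ib'] := half_edge bb'; exists i; rewrite ib'.
have [par parP] := fin_all_exists parent.
have same_edge i i' : i.1 = i'.1 -> i = i' \/ i = opp_end i'.
  by case: i i' => [j []] [j' []] /= ->; [left | right | right | left].
(* An edge that is the parent of both its ends would make each rank smaller than the other. *)
have par_inj : injective (fun b => (par b).1).
  move=> b1 b2 /same_edge[] eq; apply: val_inj.
    by rewrite -(parP b1).1 -(parP b2).1 eq.
  have [e1 lt1] := parP b1; have [e2 lt2] := parP b2.
  move: e1 lt1 lt2; rewrite eq /opp_end /= negbK -surjective_pairing e2 => ->.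
  by move=> lt1 lt2; have := ltn_trans lt1 lt2; rewrite ltnn.
pose P := [set (par b).1 | b : {b | b \in uncond2 a T}].
have cardP : #|P| = #|uncond2 a T| by rewrite card_imset // card_sig cardsE.
(* The starts are the copies in [T.1] of the edges that are nobody's parent. *)
exists [set (j, false) | j in ~: P]; split.
  rewrite -cardP addnC -[leqRHS]card_ord -(cardsC P) leq_add2l.
  exact: leq_imset_card.
move=> Y StY clY.
have nP j : j \notin P -> (j, false) \in Y.
  by move=> jP; apply: (subsetP StY); apply/imsetP; exists j; rewrite // inE.
have clY' s s' i i' : (i.1, s) \in Y ->
    endpt (pair_at T s) i = endpt (pair_at T s') i' -> (i'.1, s') \in Y.
  by move=> iY eq; apply: (clY _ _ i.2 i'.2 iY).
have step_one b i i' : b \in uncond2 a T -> i \in Gamma a b -> i' \in Gamma a b ->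
    (exists s, (i.1, s) \in Y) -> exists s, (i'.1, s) \in Y.
  move=> bT ib i'b [s iY].
  have [s' eq] := uncond2_swap s (T_cond b) bT ib i'b.
  by exists s'; apply: clY' eq.
have step_both b i i' : b \in uncond2 a T -> i \in Gamma a b -> i' \in Gamma a b ->
    (forall s, (i.1, s) \in Y) -> forall s, (i'.1, s) \in Y.
  move=> bT ib i'b iY s.
  have [s' eq] := uncond2_swap s (T_cond b) bT i'b ib.
  exact: clY' (iY s') (esym eq).
(* Induction from the largest rank down: a second edge at [b] is either a start or the parent edge
   of a vertex of larger rank. *)
have par_one n : forall b, (\max_b rank b < rank (val b) + n)%N ->
    exists s, ((par b).1, s) \in Y.
  elim: n => [|n IHn] b.
    by rewrite addn0 ltnNge leq_bigmax.
  move=> lt; have [eb rk] := parP b.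
  have bb' : H (val b) (endpt a (opp_end (par b))) by rewrite -eb adj_ends.
  have [b'' bb'' neq] := another_neighbor bb'.
  have [i ib ib''] := half_edge bb''.
  apply: (step_one (val b) i); rewrite ?inE ?eb ?ib ?(valP b) //.
    by have := valP b; rewrite inE.
  case: (boolP (i.1 \in P)) => [|/nP]; last by exists false.
  move=> /imsetP[b2 _ eq]; have [eb2 rk2] := parP b2; rewrite eq.
  apply: IHn; apply: leq_trans lt _; rewrite addnS ltn_add2r.
  case: (same_edge _ _ eq) => ei; last first.
    by move: rk2; rewrite -ei ib.
  have b2b : b2 = b by apply: val_inj; rewrite -eb2 -ei ib.
  by move: neq; rewrite -ib'' ei b2b eqxx.
have one j : exists s, (j, s) \in Y.
  case: (boolP (j \in P)) => [/imsetP[b _ ->]|/nP]; last by exists false.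
  by apply: (par_one (\max_b rank b).+1); rewrite addnS ltnS leq_addl.
(* Induction on increasing rank: where Condition 2 holds the two copies of an edge share an end;
   elsewhere both copies of the parent edge are already reached from its other end. *)
have both n : forall b, (rank b < n)%N -> forall i, i \in Gamma a b ->
    forall s, (i.1, s) \in Y.
  elim: n => // n IHn b lt i ib.
  case: (boolP (b \in uncond2 a T)) => [bT|]; last first.
    rewrite inE negbK => /forall_inP/(_ _ ib)/eqP c2.
    have [s iY] := one i.1 => s'.
    by apply: (clY' s s' i i iY); case: s s' {iY} => [] [].
  have [eb rk] := parP (Sub b bT).
  apply: (step_both b (par (Sub b bT))) => //; first by rewrite inE eb.
  apply: (IHn (endpt a (opp_end (par (Sub b bT)))) _ (opp_end (par (Sub b bT)))).
    exact: leq_trans rk _.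
  by rewrite inE.
apply/setP => -[j s]; rewrite inE.
by apply: (both _ (endpt a (j, false)) (ltnSn _) (j, false)); rewrite inE.
Qed.

End Orientation.

(** * Arithmetic of the exponents *)

Lemma leq_expn_base (m n e : nat) : (m <= n)%N -> (m ^ e <= n ^ e)%N.
Proof. by case: e => // e; rewrite leq_exp2r. Qed.

Lemma exploration_arith (m D C u v n s k : nat) :
  (0 < C)%N -> (D ^ 2 * C <= m)%N -> (C ^ 3 <= m)%N ->
  (2 * u + v = s)%N -> (s <= 2 * k)%N -> (u + n <= k)%N ->
  (m ^ u * D ^ v * C ^ (n + 2 * k) <= m ^ k * C ^ s)%N.
Proof.
move=> C0 DCm Cm uvs sk unk.
have Cv0 : (0 < C ^ v)%N by rewrite expn_gt0 C0.
(* D occurs to the power v, so both sides are squared to use D^2 C <= m. *)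
rewrite -(leq_exp2r _ _ (ltn0Sn 1)) -(leq_pmul2r Cv0).
apply: (@leq_trans (m ^ s * C ^ (2 * n + 4 * k))).
  have -> : ((m ^ u * D ^ v * C ^ (n + 2 * k)) ^ 2 * C ^ v =
      m ^ (2 * u) * (D ^ 2 * C) ^ v * C ^ (2 * n + 4 * k))%N.
    rewrite (expnMn (D ^ 2)) !(expnMn _ _ 2) -!expnM (mulnC u) (mulnC v).
    rewrite (_ : (n + 2 * k) * 2 = 2 * n + 4 * k)%N; last by lia.
    by rewrite !mulnA mulnAC.
  by rewrite -uvs (expnD m) leq_mul2r leq_mul2l leq_expn_base ?orbT.
have -> : ((m ^ k * C ^ s) ^ 2 * C ^ v =
    m ^ s * (m ^ (2 * k - s) * C ^ (2 * s + v)))%N.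
  rewrite mulnA -expnD subnKC // expnMn -!expnM -mulnA -expnD.
  by rewrite (mulnC k) (mulnC s).
rewrite leq_mul2l; apply/orP; right.
(* The exponents left to compare are 2n+4k and 3(2k-s)+2s+v = 6k-2u. *)
apply: (@leq_trans ((C ^ 3) ^ (2 * k - s) * C ^ (2 * s + v))).
  by rewrite -expnM -expnD leq_pexp2l //; lia.
by rewrite leq_mul2r leq_expn_base ?orbT.
Qed.

Lemma degree_color_bounds (R : realType) (m D C : nat) (alpha : R) :
  0 < alpha -> (0 < C)%N -> D%:R <= m%:R `^ (1 / 2 - alpha) ->
  C%:R <= Num.min (m%:R `^ (2 * alpha)) (m%:R `^ (1 / 3)) ->
  (D ^ 2 * C <= m)%N /\ (C ^ 3 <= m)%N.
Proof.
move=> al0 C0 Dm; rewrite le_min => /andP[Cm1 Cm2].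
(* If m were 0, then m^(1/3) = 0 would be below C. *)
have m0 : m%:R != 0 :> R.
  apply: contraTneq Cm2 => ->; rewrite powR0; last by rewrite mul1r invr_eq0 pnatr_eq0.
  by rewrite -ltNge ltr0n.
have mpow (x : R) (n : nat) : (m%:R `^ x) ^+ n = m%:R `^ (x * n%:R).
  by rewrite powRrM powR_mulrn // powR_ge0.
split; rewrite -(ler_nat R).
  rewrite natrM natrX.
  apply: (@le_trans _ _ ((m%:R `^ (1 / 2 - alpha)) ^+ 2 * m%:R `^ (2 * alpha))).
    by apply: ler_pM => //; rewrite ?lerXn2r ?nnegrE ?powR_ge0 ?exprn_ge0.
  rewrite mpow -powRD ?m0 ?implybT //.
  rewrite (_ : _ * 2%:R + _ = 1); first by rewrite powRr1.
  by field.
rewrite natrX; apply: (@le_trans _ _ ((m%:R `^ (1 / 3)) ^+ 3)).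
  by rewrite lerXn2r ?nnegrE ?powR_ge0.
by rewrite mpow divfK ?powRr1 ?pnatr_eq0.
Qed.

(** * Classes of pairs with one coincidence pattern *)

Section Kernel.
Variables (I V : finType) (k : nat) (a : {ffun 'I_k -> I * I}).
Implicit Types T : {ffun 'I_k -> V * V} * {ffun 'I_k -> V * V}.

(** The pattern lives in a type that does not mention V, so the number of patterns depends on k
    only. *)
Definition pair_kernel T : {set ('I_k * bool * bool) * ('I_k * bool * bool)} :=
  [set x | pair_at (pair_arc T x.1.1) x.1.2 == pair_at (pair_arc T x.2.1) x.2.2].

Lemma pair_kernelE T T' : pair_kernel T = pair_kernel T' -> forall x x' e e',
  (pair_at (pair_arc T x) e == pair_at (pair_arc T x') e') =
  (pair_at (pair_arc T' x) e == pair_at (pair_arc T' x') e').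
Proof. by move=> /setP eqT x x' e e'; have := eqT ((x, e), (x', e')); rewrite !inE. Qed.

(** Condition 2 only compares ends of arcs of T, so the pattern decides it. *)
Lemma eq_kernel_uncond2 T T' :
  pair_kernel T = pair_kernel T' -> uncond2 a T = uncond2 a T'.
Proof.
move=> /pair_kernelE eqT; apply/setP => b; rewrite !inE; congr (~~ _).
apply: eq_forallb => i; congr (_ ==> _).
exact: (eqT (i.1, false) (i.1, true) i.2 i.2).
Qed.

Lemma eq_kernel_card_verts T T' :
  pair_kernel T = pair_kernel T' -> #|pair_verts T| = #|pair_verts T'|.
Proof. by move=> /pair_kernelE eqT; apply: card_imset_kernel => x y; apply: eqT. Qed.

Variables (H : rel I) (G : rel V).
Hypotheses (H_simple : simple_graph H) (H_connected : connected_graph H).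
Hypotheses (H_no_leaves : no_leaves H) (aH : orientation H a).
Hypothesis G_simple : simple_graph G.

Definition admissible_pairs :
    {set {ffun 'I_k -> V * V} * {ffun 'I_k -> V * V}} :=
  [set T | [&& T.1 \in darc_tuples G k, T.2 \in darc_tuples G k,
      [forall b, [|| cond1 a T.1 T.2 b, cond2 a T.1 T.2 b | cond3 a T.1 T.2 b]]
    & [exists b, cond2 a T.1 T.2 b]]].

Lemma card_same_kernel g : g \in admissible_pairs -> exists u v,
  [/\ (u + #|uncond2 a g| <= k)%N, (2 * u + v)%N = #|pair_verts g|,
      (#|pair_verts g| <= 2 * k)%N
    & (#|[set T in admissible_pairs | pair_kernel T == pair_kernel g]|
       <= #|darcs G| ^ u * max_degree G ^ v)%N].
Proof.
move=> gA; have := gA; rewrite inE => /and4P[_ _ /forallP g_cond /existsP[b0 g_b0]].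
have [St [St_le St_spans]] :=
  spanning_starts H_simple H_connected H_no_leaves aH g_cond g_b0.
have [||||u [v [uSt uv le]]] := @card_exploration _ _ _ G (@pair_arc V k)
  [set T in admissible_pairs | pair_kernel T == pair_kernel g] g St
  G_simple.1 G_simple.2 _ _ _ _ St_spans.
- move=> [f1 f2] [f1' f2'] eqf; congr (_, _); apply/ffunP => j.
    exact: eqf (j, false).
  exact: eqf (j, true).
- move=> f [j s]; rewrite inE => /andP[]; rewrite inE => /and4P[f1 f2 _ _] _.
  move: f1 f2; rewrite !inE => /forallP/(_ j) + /forallP/(_ j).
  by rewrite !inE; case: s.
- by rewrite inE gA eqxx.
- by move=> f; rewrite inE => /andP[_ /eqP/pair_kernelE].
exists u, v; split=> //; first by apply: leq_trans St_le; rewrite leq_add2r.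
exact: card_pair_verts H_simple H_no_leaves aH _ g_cond.
Qed.

Lemma sum_same_kernel (R : realType) (C : nat) p :
  (0 < C)%N -> (max_degree G ^ 2 * C <= #|darcs G|)%N -> (C ^ 3 <= #|darcs G|)%N ->
  \sum_(T in admissible_pairs | pair_kernel T == p)
    C%:R ^+ (#|I| + #|uncond2 a T|) / C%:R ^+ #|pair_verts T|
  <= #|darcs G|%:R ^+ k * C%:R ^+ #|I| / C%:R ^+ (2 * k) :> R.
Proof.
move=> C0 DCm Cm; have C0R : 0 < C%:R :> R by rewrite ltr0n.
case: (set_0Vmem [set T in admissible_pairs | pair_kernel T == p]) => [A0|[g]].
  rewrite big_pred0 => [|T]; first by rewrite !mulr_ge0 ?invr_ge0 ?exprn_ge0.
  by move/setP/(_ T): A0; rewrite !inE.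
rewrite inE => /andP[gA /eqP gp].
have [u [v [un uv sk le]]] := card_same_kernel gA.
rewrite (eq_bigr (fun=> C%:R ^+ (#|I| + #|uncond2 a g|) / C%:R ^+ #|pair_verts g|));
  last first.
  move=> T /andP[_ /eqP Tp].
  by rewrite (@eq_kernel_uncond2 T g) ?(@eq_kernel_card_verts T g) ?Tp.
rewrite -gp sumr_const.
rewrite -[leLHS]mulr_natr [leLHS]mulrAC ler_pdivrMr ?exprn_gt0 //.
rewrite [leRHS]mulrAC ler_pdivlMr ?exprn_gt0 //.
rewrite -!natrX -!natrM ler_nat.
have le' : (#|[pred T in admissible_pairs | pair_kernel T == pair_kernel g]| *
    C ^ (#|uncond2 a g| + 2 * k) <= #|darcs G| ^ k * C ^ #|pair_verts g|)%N.
  apply: leq_trans (exploration_arith C0 DCm Cm uv sk un).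
  by rewrite leq_mul2r; apply/orP; right; rewrite cardsE in le.
rewrite [leqRHS]mulnAC [leqRHS]mulnC (expnD _ #|I|) -!mulnA leq_mul2l.
by apply/orP; right; rewrite mulnCA -expnD.
Qed.

End Kernel.

Theorem theorem3p10 (R : realType) (t k : nat) (H : rel 'I_t)
    (H_simple : simple_graph H) (H_connected : connected_graph H)
    (H_no_leaves : no_leaves H) :
  exists K : R,
    forall (a : {ffun 'I_k -> 'I_t * 'I_t}), orientation H a ->
    forall (V : finType) (G : rel V), simple_graph G ->
    forall (C : nat) (W : finType) (h : W -> V -> 'I_C),
      hash_family R (4 * k) h ->
    forall alpha : R, 0 < alpha ->
    let m := #|darcs G| in
    (max_degree G)%:R <= m%:R `^ (1 / 2 - alpha) ->
    (t <= C)%N ->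
    C%:R <= Num.min (m%:R `^ (2 * alpha)) (m%:R `^ (1 / 3)) ->
    uexpect (fun w => #|counted_pairs a G (h w)|%:R)
      <= K * (m%:R ^+ k / C%:R ^ ((2 * k)%:Z - t%:Z)).
Proof.
(* The constant is the number of conceivable patterns, 2^(16k^2). *)
exists #|{set ('I_k * bool * bool) * ('I_k * bool * bool)}|%:R.
move=> a aH V G G_simple C W h hash alpha al0 m Dm tC Cm.
have t0 : (0 < t)%N by have := H_connected.1; rewrite card_ord.
have C0 : (0 < C)%N := leq_trans t0 tC.
have [DCm C3m] := degree_color_bounds al0 C0 Dm Cm.
have C0R : C%:R != 0 :> R by rewrite pnatr_eq0 -lt0n.
(* The integer exponent is split because 2k - t is negative when H is a single vertex. *)
have -> : m%:R ^+ k / C%:R ^ ((2 * k)%:Z - t%:Z) =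
    m%:R ^+ k * C%:R ^+ #|'I_t| / C%:R ^+ (2 * k) :> R.
  by rewrite card_ord expfzDr // -exprnN invfM invrK -exprnP mulrA mulrAC.
pose compat w (T : {ffun 'I_k -> V * V} * {ffun 'I_k -> V * V}) :=
  distinctly_compatible a (h w) T.1 && distinctly_compatible a (h w) T.2.
have -> : uexpect (fun w => #|counted_pairs a G (h w)|%:R) =
    \sum_(T in admissible_pairs a G) #|[set w | compat w T]|%:R / #|W|%:R :> R.
  rewrite /uexpect -mulr_suml; congr (_ / _).
  rewrite -!natr_sum; congr _%:R.
  transitivity (\sum_w \sum_(T in admissible_pairs a G) compat w T)%N.
    apply: eq_bigr => w _; rewrite -sum1_card big_mkcond [RHS]big_mkcond /=.
    apply: eq_bigr => T _; rewrite /compat [T \in counted_pairs _ _ _]inE.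
    rewrite [T \in admissible_pairs _ _]inE.
    case: (T.1 \in _) => //=; case: (T.2 \in _) => //=.
    case: (distinctly_compatible _ _ T.1) => /=; last by case: ifP.
    case: (distinctly_compatible _ _ T.2) => //=; last by case: ifP.
  rewrite exchange_big; apply: eq_bigr => T _.
  by rewrite -sum1_card [RHS]big_mkcond; apply: eq_bigr => w _; rewrite inE; case: ifP.
apply: (@le_trans _ _ (\sum_(T in admissible_pairs a G)
    C%:R ^+ (#|'I_t| + #|uncond2 a T|) / C%:R ^+ #|pair_verts T|)).
  apply: ler_sum => T; rewrite inE => /and4P[_ _ /forallP T_cond /existsP[b0 _]].
  apply: (prob_compatible a b0 hash).
  apply: leq_trans (card_pair_verts H_simple H_no_leaves aH T_cond) _.
  by rewrite leq_mul2r orbT.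
rewrite (partition_big (@pair_kernel V k) xpredT) //= mulr_natl -sumr_const.
by apply: ler_sum => p _; apply: (sum_same_kernel H_simple).
Qed.
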